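(* Let $f(x)=a_nx^n+\dots+a_0$ be a polynomial of degree $n$ with integer coefficients and let $q$ be an odd prime. Suppose $a_0\not\equiv 0 \pmod q$ and that the congruence $f(x)\equiv 0\pmod q$ has $\ell$ solutions in $\mathbb{Z}_q$. Then $$R(f(x),x^{q-1}-1)= a_n^{q-1}\prod_{i=1}^n(\alpha_i^{q-1}-1)\equiv 0 \pmod{q^\ell},$$ where $\alpha_1,\dots,\alpha_n$ are the complex roots of $f(x)$, each repeated according to its multiplicity.
   Context: For $f(x)=\sum_{i=0}^n a_i x^i$ and $g(x)=\sum_{j=0}^m b_j x^j$ of degrees $n$ and $m$, the resultant $R(f,g)$ is the determinant of the Sylvester matrix; equivalently $R(f,g)=a_n^m\prod_{i=1}^n g(\alpha_i)$, where $\alpha_i$ are the roots of $f$ with multiplicity. *)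

(* Defs.v *)
From mathcomp Require Import all_boot all_order all_algebra.
From mathcomp Require Import reals complex.

(* Sign convention for the library's [resultant]: its Sylvester matrix lists
   the coefficients in ascending order.  For p of degree n with leading
   coefficient a_n and roots alpha_i, and g of degree m, this gives
     resultant p g = (-1)^(n m) a_n^m \prod_i g(alpha_i),
   i.e. (-1)^(n m) times the determinant of the Sylvester matrix in descending
   order.  The two agree for g = 'X^(q-1) - 1 with q odd, since m is even. *)

(* Main.v *)
(* Two facts about the Sylvester matrix S of f and g.
   If g = prod (X - b_j) with m roots, rewrite the rows of S in the Newton basis
   h_i = prod_(j < i) (X - b_j), where b_j = 0 for j >= m: since
   h_i f - f(b_i) h_i is a multiple of h_(i+1), S becomes triangular and
   det S = prod f(b_j).  For f = a prod (X - alpha_i) this equals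
   (-1)^(n m) a^m prod g(alpha_i), and m = q - 1 is even.
   Modulo q, the polynomial h = prod (X - x) over the l roots x of f divides f
   and, by Fermat, X^(q-1) - 1.  So every row of S mod q is the coefficient
   vector of a multiple of h, the rank of S mod q is at most its size minus l,
   and q^l divides det S. *)
Require Import Defs.
From mathcomp Require Import all_boot all_order all_algebra.
From mathcomp Require Import finfield.
From mathcomp Require Import reals complex.
From mathcomp Require Import zify.

Import Order.TTheory GRing.Theory Num.Theory.
Local Open Scope ring_scope.

(** * Newton basis polynomials *)

Section NewtonBasis.

Variables (R : comNzRingType) (b : nat -> R).

Definition newton_poly i : {poly R} := \prod_(0 <= j < i) ('X - (b j)%:P).

Lemma newton_polyS i : newton_poly i.+1 = newton_poly i * ('X - (b i)%:P).
Proof. exact: big_nat_recr. Qed.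

Lemma monic_newton_poly i : newton_poly i \is monic.
Proof. exact: monic_prod_XsubC. Qed.

Lemma size_newton_poly i : size (newton_poly i) = i.+1.
Proof. by rewrite size_prod_XsubC size_iota subn0. Qed.

(** Dividing [p - p(b_i)] by [X - b_i] gives a quotient [q] of smaller size with
    [h_i p = p(b_i) h_i + h_(i+1) q], so induction on the size bound [d] expands the last term. The
    bound [i + d <= N] keeps all indices below [N]. *)
Lemma newton_expansion N d i (p : {poly R}) :
    (size p <= d)%N -> (i + d <= N)%N ->
  exists c : nat -> R, [/\ c i = p.[b i], forall j, (j < i)%N -> c j = 0
    & newton_poly i * p = \sum_(j < N) c j *: newton_poly j].
Proof.
elim: d i p => [|d IHd] i p.
  rewrite leqn0 size_poly_eq0 => /eqP-> _; exists (fun=> 0).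
  split=> //; first by rewrite horner0.
  by rewrite mulr0 big1 // => j _; rewrite scale0r.
move=> sz_p leN.
have /factor_theorem[q Dq] : root (p - (p.[b i])%:P) (b i).
  by rewrite rootE !hornerE subrr.
have sz_q : (size q <= d)%N.
  have [->|q_neq0] := eqVneq q 0; first by rewrite size_poly0.
  have := size_Mmonic q_neq0 (monicXsubC (b i)).
  rewrite -Dq size_XsubC addn2 /= -ltnS => <-.
  rewrite (leq_trans (size_polyD _ _)) // geq_max sz_p size_polyN.
  exact: leq_trans (size_polyC_leq1 _) _.
have [|c [_ c0 Dc]] := IHd i.+1 q sz_q; first by rewrite addSnnS.
exists (fun j => if j == i then p.[b i] else c j); rewrite eqxx.
split=> // [j lt_ji|]; first by rewrite ltn_eqF // c0 // ltnW.
have lt_iN : (i < N)%N by lia.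
rewrite -[p in LHS](subrK (p.[b i])%:P) Dq mulrDr [q * _]mulrC mulrA.
rewrite -newton_polyS Dc (bigD1 (Ordinal lt_iN)) //= c0 // scale0r add0r.
rewrite [RHS](bigD1 (Ordinal lt_iN)) //= eqxx mulrC mul_polyC addrC.
congr (_ + _).
by apply: eq_bigr => j ne_ji; rewrite -val_eqE /= in ne_ji; rewrite (negPf ne_ji).
Qed.

End NewtonBasis.

(** * Resultants as products over roots *)

Lemma row_Sylvester_mx (R : nzRingType) (p q : {poly R}) i :
  row i (Sylvester_mx p q)
    = poly_rV (match split i with inl k => 'X^k * p | inr k => 'X^k * q end).
Proof.
apply/rowP=> j; rewrite [LHS]mxE [RHS]mxE Sylvester_mxE /=.
by case: (split i) => k; rewrite coefXnM ltnNge; case: leqP.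
Qed.

Lemma resultant_prod_XsubC (R : comNzRingType) (f : {poly R}) (s : seq R) :
  resultant f (\prod_(b <- s) ('X - b%:P)) = \prod_(b <- s) f.[b].
Proof.
set g := \prod_(b <- s) _.
have sz_g : (size g).-1 = size s by rewrite size_prod_XsubC.
rewrite (big_nth 0) big_mkord -sz_g.
pose h := newton_poly R (nth 0 s).
have gE : g = h (size g).-1 by rewrite sz_g /g (big_nth 0).
rewrite /resultant; set m := (size g).-1 in gE *; set n := (size f).-1.
(* Past the end of [s] the default [0] of [nth] makes each new Newton factor equal to ['X]. *)
have hD k : h (m + k)%N = 'X^k * g.
  elim: k => [|k IHk]; first by rewrite addn0 mul1r.
  rewrite addnS /h newton_polyS -/h IHk nth_default ?subr0; last first.
    by rewrite -sz_g leq_addr.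
  by rewrite -mulrA [g * _]mulrC mulrA exprSr.
pose F (i : nat) := if (i < m)%N then f else 1.
have exM (i : 'I_(m + n)) : exists c : nat -> R,
    [/\ c i = (F i).[nth 0 s i], forall j, (j < i)%N -> c j = 0
      & h i * F i = \sum_(j < m + n) c j *: h j].
  rewrite /F; case: ltnP => [lt_im|le_mi].
    apply: (@newton_expansion _ _ _ (size f)) => //.
    by rewrite (leq_trans (leq_add (leqnn i) (leqSpred _))) // addnS -addSn leq_add2r.
  by apply: (@newton_expansion _ _ _ 1); rewrite ?size_poly1 // addn1.
have [c cP] := fin_all_exists exM.
(* [B] holds the Newton basis and [M] the expansions in it. [P] turns the rows ['X^i * f] into
   [h i * f] and fixes the rows ['X^k * g]. Since [P] and [B] are unitriangular, the resultant is
   [\det M]. *)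
pose M : 'M[R]_(m + n) := \matrix_(i, j) c i j.
pose B : 'M[R]_(m + n) := \matrix_(i, j) (h i)`_j.
pose L : 'M[R]_m := \matrix_(i, j) (h i)`_j.
pose P : 'M[R]_(m + n) := block_mx L 0 0 1%:M.
have det_h k : \det (\matrix_(i < k, j < k) (h i)`_j) = 1.
  rewrite det_trig.
    rewrite big1 // => i _; rewrite mxE.
    have /monicP := monic_newton_poly _ (nth 0 s) i.
    by rewrite /lead_coef size_newton_poly.
  by apply/is_trig_mxP=> i j lt_ij; rewrite mxE nth_default ?size_newton_poly.
have rowB (i : 'I_(m + n)) : row i B = poly_rV (h i).
  by apply/rowP=> j; rewrite !mxE.
have PS : P *m Sylvester_mx f g = M *m B.
  apply/row_matrixP=> i.
  have -> : row i (M *m B) = poly_rV (h i * F i).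
    have [_ _ ->] := cP i; rewrite row_mul mulmx_sum_row linear_sum /=.
    by apply: eq_bigr => j _; rewrite rowB !mxE linearZ.
  rewrite mul_block_col !mul0mx mul1mx addr0 add0r /F.
  case: (split_ordP i) => k ->.
    rewrite rowKu row_mul mul_rV_lin1 /=; congr (poly_rV (_ * _)).
    have -> : row k L = poly_rV (h k) by apply/rowP=> j; rewrite !mxE.
    by rewrite poly_rV_K // size_newton_poly.
  rewrite rowKd mulr1 hD rowE mul_rV_lin1 /=.
  by rewrite rVpoly_delta.
have /(congr1 determinant) := PS; rewrite !det_mulmx det_lblock det1 !det_h.
(* [M] is upper triangular and [det_trig] expects lower triangular, hence the transpose. *)
rewrite !mul1r mulr1 => ->; rewrite -det_tr det_trig; last first.
  apply/is_trig_mxP=> i j lt_ij; rewrite !mxE.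
  by have [_ ->] := cP j.
rewrite big_split_ord /= [X in _ * X]big1 ?mulr1 => [|k _].
  apply: eq_bigr => k _; rewrite !mxE.
  by have [-> _ _] := cP (lshift n k); rewrite /F /= ltn_ord.
rewrite !mxE; have [-> _ _] := cP (rshift m k).
by rewrite /F /= ltnNge leq_addr hornerC.
Qed.

(** Evaluating the first polynomial at each [y] gives factors [y - x]; exchanging the products and
    turning each into [x - y] produces the sign. *)
Lemma resultant_scale_prod_XsubC (R : comNzRingType) a (r s : seq R) :
  resultant (a *: \prod_(x <- r) ('X - x%:P)) (\prod_(y <- s) ('X - y%:P))
    = (-1) ^+ (size r * size s) * a ^+ size s
      * \prod_(x <- r) (\prod_(y <- s) ('X - y%:P)).[x].
Proof.
rewrite resultant_prod_XsubC.
under eq_bigr => y _ do rewrite hornerZ horner_prod.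
have constE (t : seq R) (x : R) : \prod_(y <- t) x = x ^+ size t.
  by rewrite big_const_seq count_predT iter_mulr_1.
rewrite big_split /= constE exchange_big /=.
rewrite [_ * a ^+ _]mulrC -mulrA; congr (_ * _).
rewrite mulnC exprM -[X in X * _](constE r) -big_split /=.
apply: eq_bigr => x _; rewrite horner_prod -constE -big_split /=.
by apply: eq_bigr => y _; rewrite !hornerE mulN1r opprB.
Qed.

(** Equal sizes keep the two Sylvester matrices of the same shape. This serves the embedding into
    the complex numbers; modulo [q] the degree of [f] may drop. *)
Lemma map_resultant_size (aR rR : comNzRingType) (phi : {rmorphism aR -> rR})
    (p q : {poly aR}) :
    size (map_poly phi p) = size p -> size (map_poly phi q) = size q ->
  phi (resultant p q) = resultant (map_poly phi p) (map_poly phi q).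
Proof.
move=> sz_p sz_q; rewrite /resultant /Sylvester_mx sz_p sz_q -det_map_mx.
rewrite map_col_mx; congr (\det (col_mx _ _));
  by apply: map_lin1_mx => v; rewrite map_poly_rV rmorphM /= map_rVpoly.
Qed.

(** * Prime powers dividing a determinant *)

Lemma dvdz_det_rows N k (d : int) (A : 'M[int]_N) :
    (forall i j : 'I_N, (k <= i)%N -> (d %| A i j)%Z) ->
  (d ^+ (N - k) %| \det A)%Z.
Proof.
(* One factor [d] is pulled out of each of the last [N - k] rows. *)
move=> dvdA; pose D : 'rV[int]_N := \row_i (if (k <= i)%N then d else 1).
pose A' := \matrix_(i, j) (if (k <= i)%N then (A i j %/ d)%Z else A i j).
have -> : A = diag_mx D *m A'.
  apply/matrixP=> i j; rewrite mul_diag_mx !mxE.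
  by case: ifP => [/dvdA dvdAij|_]; rewrite ?mul1r // mulrC divzK.
rewrite det_mulmx det_diag; under eq_bigr => i _ do rewrite mxE.
rewrite -big_mkcond -(big_geq_mkord _ _ xpredT (fun=> d)) prodr_const_nat.
exact: dvdz_mulr.
Qed.

(** Row reduction modulo [p] clears all rows beyond the rank. An integer lift [P] of the reducing
    matrix has determinant prime to [p], so the power of [p] found in [\det (P *m A)] already
    divides [\det A]. *)
Lemma dvdz_det_rank p N l (A : 'M[int]_N) :
    prime p -> (\rank (map_mx (intr : int -> 'F_p) A) + l <= N)%N ->
  ((p ^ l)%N %| \det A)%Z.
Proof.
move=> p_pr le_rN; set Abar := map_mx _ A in le_rN *.
have dvdE (x : int) : (p %| x)%Z = (x%:~R == 0 :> 'F_p).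
  exact: dvdz_pcharf (pchar_Fp p_pr) x.
pose U := invmx (col_ebase Abar).
pose P : 'M[int]_N := map_mx (fun x : 'F_p => (x : nat)%:Z) U.
have PE : map_mx intr P = U.
  by apply/matrixP=> i j; rewrite !mxE -pmulrn natr_Zp.
have coP : coprimez (p ^ l)%N (\det P).
  rewrite -[(p ^ l)%N%:Z]natz natrX natz coprimezXl // coprimezE.
  rewrite prime_coprime // -[(_ %| _)%N]/(p %| \det P)%Z dvdE.
  by rewrite -det_map_mx PE -unitfE -unitmxE unitmx_inv col_ebase_unit.
rewrite -(Gauss_dvdzr _ coP) -det_mulmx.
apply: dvdz_trans (dvdz_det_rows N (\rank Abar) p _ _).
  rewrite -[(p ^ l)%N%:Z]natz natrX natz dvdz_exp2l //; lia.
move=> i j le_ri; rewrite dvdE.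
have -> : ((P *m A) i j)%:~R = (map_mx (intr : int -> 'F_p) (P *m A)) i j.
  by rewrite [RHS]mxE.
rewrite map_mxM PE -/Abar -[X in _ *m X](mulmx_ebase Abar) -mulmxA mulKmx ?col_ebase_unit //.
rewrite mxE big1 // => k _; rewrite !mxE.
by rewrite ltnNge le_ri andbF mul0r.
Qed.

(** The rows lie in the row space of multiplication by [h], a matrix with only [N - deg h] rows. The
    Sylvester matrix is mapped entrywise, since [phi] may kill leading coefficients. *)
Lemma rank_map_Sylvester_mx (R : nzRingType) (F : fieldType)
    (phi : {rmorphism R -> F}) (p q : {poly R}) (h : {poly F}) :
    h != 0 -> ((size h).-1 <= (size q).-1 + (size p).-1)%N ->
    h %| map_poly phi p -> h %| map_poly phi q ->
  (\rank (map_mx phi (Sylvester_mx p q)) + (size h).-1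
     <= (size q).-1 + (size p).-1)%N.
Proof.
set N := ((size q).-1 + _)%N => h_neq0 sz_h h_p h_q.
pose H : 'M[F]_(N - (size h).-1, N) := lin1_mx (poly_rV \o h \o* rVpoly).
rewrite addnC -leq_subRL //; apply: leq_trans (rank_leq_row H).
apply: mxrankS; apply/row_subP=> i.
have rowH (e : {poly F}) : h %| e -> (size e <= N)%N -> (poly_rV e <= H)%MS.
  move=> h_e sz_e; rewrite -(divpK h_e).
  have <- : poly_rV (e %/ h) *m H = poly_rV (e %/ h * h).
    by rewrite mul_rV_lin1 /= poly_rV_K // size_divp // leq_sub2r.
  exact: submxMl.
have sz_row (r : {poly R}) k M : (k < M)%N ->
    (size ('X^k * map_poly phi r)%R <= M + (size r).-1)%N.
  move=> lt_kM; apply: leq_trans (size_polyMleq _ _) _.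
  rewrite size_polyXn addSn /=.
  have sz_r : (size (map_poly phi r) <= size r)%N by apply: size_poly.
  rewrite (leq_trans (leq_add (leqnn k) (leq_trans sz_r (leqSpred _)))) //.
  by rewrite addnS -addSn leq_add2r.
rewrite -map_row row_Sylvester_mx map_poly_rV.
case: (split i) => k; apply: rowH; rewrite rmorphM /= map_polyXn ?dvdp_mull //.
  exact: sz_row.
by rewrite /N addnC sz_row.
Qed.

Lemma poly_roots_count (F : closedFieldType) (p : {poly F}) (s : seq F) :
    p != 0 -> (forall z, count_mem z s = mup z p) ->
  p = lead_coef p *: \prod_(z <- s) ('X - z%:P).
Proof.
move=> p_neq0 countE; have [r Dp] := closed_field_poly_normal p.
rewrite {1}Dp; congr (_ *: _); apply: perm_big; apply/allP=> z _ /=.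
rewrite countE {1}Dp -mul_polyC mupMr ?mu_prod_XsubC //.
by rewrite rootC lead_coef_eq0.
Qed.

Theorem theorem2 (R : realType) (n q l : nat) (f : {poly int})
    (alpha : n.-tuple R[i]) :
  size f = n.+1 ->
  prime q -> odd q ->
  (f`_0 <> 0 %[mod q])%Z ->
  #|[set x : 'F_q | root (map_poly (intr : int -> 'F_q) f) x]| = l ->
  (forall z : R[i],
     count_mem z alpha = mup z (map_poly (intr : int -> R[i]) f)) ->
  (resultant f ('X^(q.-1) - 1))%:~R
    = (f`_n)%:~R ^+ q.-1 * \prod_(i < n) (tnth alpha i ^+ q.-1 - 1) :> R[i]
  /\ (resultant f ('X^(q.-1) - 1) = 0 %[mod (q ^ l)%N])%Z.
Proof.
move=> sz_f q_pr q_odd f0 card_roots countE.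
have q1_gt0 : (0 < q.-1)%N by rewrite -ltnS prednK ?prime_gt0 ?prime_gt1.
have sz_g (A : nzRingType) : size ('X^(q.-1) - 1 : {poly A}) = q.-1.+1.
  by rewrite -polyC1 size_XnsubC.
have map_g (A : nzRingType) :
    map_poly (intr : int -> A) ('X^(q.-1) - 1) = 'X^(q.-1) - 1.
  by rewrite rmorphB /= map_polyXn rmorph1.
split.
  have f_neq0 : map_poly (intr : int -> R[i]) f != 0.
    by rewrite map_poly_eq0_id0 -?size_poly_gt0 ?sz_f // intr_eq0
      lead_coef_eq0 -size_poly_gt0 sz_f.
  have sz_fC : size (map_poly (intr : int -> R[i]) f) = size f.
    by apply: size_map_inj_poly => //; apply: intr_inj.
  have [s Dg] := closed_field_poly_normal ('X^(q.-1) - 1 : {poly R[i]}).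
  have g_monic : ('X^(q.-1) - 1 : {poly R[i]}) \is monic.
    by rewrite -polyC1 monicXnsubC.
  rewrite (monicP g_monic) scale1r in Dg.
  have sz_s : size s = q.-1.
    by apply/succn_inj; rewrite -(sz_g R[i]) Dg size_prod_XsubC.
  rewrite map_resultant_size ?map_g ?sz_g // (poly_roots_count _ _ _ f_neq0 countE).
  rewrite Dg resultant_scale_prod_XsubC -Dg sz_s -signr_odd oddM.
  have -> : odd q.-1 = false by move: q_odd; case: (q) q1_gt0 => //= k _ /negPf.
  rewrite andbF mul1r /lead_coef sz_fC sz_f coef_map /=; congr (_ * _).
  by rewrite big_tuple; apply: eq_bigr => i _; rewrite !hornerE.
set fq := map_poly _ f in card_roots.
pose rts := enum [set x : 'F_q | root fq x].
pose h : {poly 'F_q} := \prod_(x <- rts) ('X - x%:P).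
have sz_h : size h = l.+1 by rewrite size_prod_XsubC -cardE card_roots.
have uniq_rts : uniq_roots rts by rewrite uniq_rootsE enum_uniq.
have rootf x : x \in rts -> root fq x by rewrite mem_enum inE.
have h_f : h %| fq by apply: uniq_roots_dvdp => //; apply/allP.
have h_g : h %| 'X^(q.-1) - 1.
  apply: uniq_roots_dvdp => //; apply/allP=> x /rootf fx0.
  have x_neq0 : x != 0.
    apply: contraPneq f0 => x0; move: fx0.
    rewrite x0 rootE horner_coef0 coef_map /= -(dvdz_pcharf (pchar_Fp q_pr)).
    by move/dvdz_mod0P=> ->; rewrite mod0z; apply.
  (* Multiplying by the nonzero [x] reduces the claim to Fermat's [x ^+ q = x]. *)
  rewrite rootE !hornerE subr_eq0 -(inj_eq (mulfI x_neq0)) mulr1 -exprS.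
  by rewrite prednK ?prime_gt0 // -[X in x ^+ X](card_Fp q_pr) expf_card.
rewrite mod0z; apply/dvdz_mod0P; apply: dvdz_det_rank => //.
have := rank_map_Sylvester_mx _ _ (intr : {rmorphism int -> 'F_q}) f
  ('X^(q.-1) - 1) h.
rewrite map_g sz_h; apply=> //; first by rewrite -size_poly_gt0 sz_h.
(* The number of roots is at most [q - 1] because [h] divides ['X^(q.-1) - 1]. *)
have g_neq0 : 'X^(q.-1) - 1 != 0 :> {poly 'F_q} by rewrite -size_poly_gt0 sz_g.
have := dvdp_leq g_neq0 h_g; rewrite sz_h !sz_g ltnS => le_l.
exact: leq_trans le_l (leq_addr _ _).
Qed.
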